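(* Let $\Psi=(\theta,\psi)$ be an affine flow on $B\times H$ with linear part $\Phi=(\theta,\varphi)$ and inhomogeneity $f:B\to L^\infty(\mathbb{R},H)$, and put $H^1:=H\times\mathbb{R}$. Then $\Psi$ can be lifted to a linear flow $\Psi^1$ on $B\times H^1$ by defining, for $(t,b,x,r)\in\mathbb{R}\times B\times H\times\mathbb{R}$, $$\Psi^1_t(b,x,r)=\Big(\theta_t b,\ \varphi(t,b,x)+r\int_0^t\varphi(t-s,\theta_s b,f(b)(s))\,ds,\ r\Big);$$ that is, this formula defines a linear flow on $B\times H^1$.
   Context: A flow on a metric space $X$ is a continuous map $\Phi:\mathbb{R}\times X\to X$ with $\Phi(0,x)=x$ and $\Phi(t+s,x)=\Phi(t,\Phi(s,x))$; write $\Phi_t(x)=\Phi(t,x)$. $B$ is a compact metric space with a chain transitive flow $\theta$ and $H$ is a finite dimensional real Hilbert space. (Chain transitive: for all $b,b'\in B$ and all $\varepsilon,T>0$ there are $n\ge1$, $T_0,\dots,T_{n-1}\ge T$ and $b_0=b,b_1,\dots,b_n=b'$ in $B$ with $d(\theta_{T_i}b_i,b_{i+1})<\varepsilon$ for all $i$.) A linear flow on $B\times H$ is a flow of the form $\Phi_t(b,x)=(\theta_tb,\varphi(t,b,x))$ where $\theta$ is a flow on $B$ and $\varphi(t,b,\cdot)$ is linear in $x\in H$. An affine flow on $B\times H$ is a continuous map $\Psi=(\theta,\psi):\mathbb{R}\times B\times H\to B\times H$ for which there are a linear flow $\Phi=(\theta,\varphi)$ (the linear part) and a function $f:B\to L^\infty(\mathbb{R},H)$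 such that $f(b)(t+s)=f(\theta_sb)(t)$ for all $b\in B$ and almost all $t,s\in\mathbb{R}$, and $$\Psi_t(b,x)=(\theta_tb,\psi(t,b,x))=\Big(\theta_tb,\ \varphi(t,b,x)+\int_0^t\varphi(t-s,\theta_sb,f(b)(s))\,ds\Big)$$ for all $(t,b,x)\in\mathbb{R}\times B\times H$. *)

(* Defs.v *)
From HB Require Import structures.
From mathcomp Require Import all_boot all_order all_algebra sesquilinear.
From mathcomp Require Import all_classical all_reals all_analysis ess_sup_inf.

Set Implicit Arguments.
Unset Strict Implicit.
Unset Printing Implicit Defensive.

Import Order.TTheory GRing.Theory Num.Theory.
Import numFieldNormedType.Exports.

Local Open Scope classical_set_scope.
Local Open Scope ring_scope.

#[short(type="normedVectType")]
HB.structure Definition NormedVector (R : realType) :=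
  {H of NormedModule R H & Vector R H}.

(* Completeness is not required: it is automatic in finite dimension. *)
HB.mixin Record NormedVector_isFinHilbert (R : realType) H
    & NormedVector R H := {
  inner : {dot H for idfun} ;
  sqr_norm_inner : forall x : H, `|x| ^+ 2 = inner x x
}.

#[short(type="finHilbertType")]
HB.structure Definition FinHilbert (R : realType) :=
  {H of NormedVector R H & NormedVector_isFinHilbert R H}.

Section flow.
Context {R : realType}.

Definition flow {X : topologicalType} (Phi : R -> X -> X) : Prop :=
  [/\ continuous (fun p : R * X => Phi p.1 p.2),
      forall x, Phi 0 x = x &
      forall t s x, Phi (t + s) x = Phi t (Phi s x)].

Definition chain_transitive {B : metricType R} (theta : R -> B -> B) : Prop :=
  forall (b b' : B) (eps T : R), 0 < eps -> 0 < T ->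
  exists (n : nat) (times : nat -> R) (pts : nat -> B),
    [/\ (1 <= n)%N, pts 0%N = b, pts n = b' &
        forall i, (i < n)%N ->
          T <= times i /\ mdist (theta (times i) (pts i)) (pts i.+1) < eps].

Definition skew {B H : Type} (theta : R -> B -> B) (phi : R -> B -> H -> H)
    (t : R) (p : B * H) : B * H :=
  (theta t p.1, phi t p.1 p.2).

(* Only the topology and the linear structure of [H] matter here, so that this
   also applies to [H * R^o] with the (equivalent) max norm of the library;
   [B * H] carries the product topology. *)
Definition linear_flow {B : metricType R} {H : normedModType R}
    (theta : R -> B -> B) (phi : R -> B -> H -> H) : Prop :=
  [/\ flow theta,
      forall t b, linear (phi t b) &
      flow (skew theta phi)].

End flow.

Section affine.
Context {R : realType}.

Local Notation mu := (@lebesgue_measure R).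

(* Elements are Borel representatives of the classes of L^oo(R, H); all the
   notions below are invariant under modification on a null set. *)
Record Linfty (H : normedModType R) := {
  Linfty_fun :> R -> H ;
  Linfty_measurable :
    measurable_fun [set: R] (Linfty_fun : R -> g_sigma_algebraType (@open H)) ;
  Linfty_bounded : (ess_sup mu (fun s => `|Linfty_fun s|%:E) < +oo)%E
}.

(* Integral of a vector-valued function, computed coordinatewise. For
   integrable functions it does not depend on the basis. *)
Definition vintegral {H : normedVectType R} (D : set R) (g : R -> H) : H :=
  \sum_(i < \dim {:H})
    Rintegral mu D (fun s => coord (vbasis {:H}) i (g s))
      *: (vbasis {:H})`_i.

Definition vintegral0 {H : normedVectType R} (t : R) (g : R -> H) : H :=
  if 0 <= t then vintegral `[0, t] g else - vintegral `[t, 0] g.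

Definition forcing {B : Type} {H : normedVectType R} (theta : R -> B -> B)
    (phi : R -> B -> H -> H) (f : B -> Linfty H) (t : R) (b : B) : H :=
  vintegral0 t (fun s => phi (t - s) (theta s b) (f b s)).

(* The exceptional null set of t may depend on s: [f (theta s b)] is a class,
   hence given up to a null set for each s separately. *)
Definition affine_flow {B : metricType R} {H : finHilbertType R}
    (theta : R -> B -> B) (phi : R -> B -> H -> H) (f : B -> Linfty H)
    (psi : R -> B -> H -> H) : Prop :=
  [/\ linear_flow theta phi,
      forall b, {ae mu, forall s, {ae mu, forall t,
        f b (t + s) = f (theta s b) t}},
      forall t b x, psi t b x = phi t b x + forcing theta phi f t b &
      continuous (fun p : R * (B * H) => skew theta psi p.1 p.2)].

Definition affine_lift {B : Type} {H : normedVectType R} (theta : R -> B -> B)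
    (phi : R -> B -> H -> H) (f : B -> Linfty H)
    (t : R) (b : B) (xr : H * R^o) : H * R^o :=
  (phi t b xr.1 + xr.2 *: forcing theta phi f t b, xr.2).

End affine.

(* Main.v *)
(** Continuity of the lift is inherited from [phi] and from
    [forcing t b = psi t b 0]. The flow property reduces to the cocycle identity
    [forcing (t + s) b
       = phi t (theta s b) (forcing s b) + forcing t (theta s b)].
    Splitting the integral at [s], pulling the linear map [phi t (theta s b)]
    out of the first part and translating the second, this follows from
    [f b (t + s) = f (theta s b) t], but only for almost every [s]. Both sides
    are continuous in [s], so it holds for every [s]. *)

From HB Require Import structures.
Require Import Defs.
From mathcomp Require Import all_boot all_order all_algebra sesquilinear.
From mathcomp Require Import all_classical all_reals all_analysis.
From mathcomp Require Import ess_sup_inf measurable_realfun ring.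

Set Implicit Arguments.
Unset Strict Implicit.
Unset Printing Implicit Defensive.

Import Order.TTheory GRing.Theory Num.Theory.
Import numFieldNormedType.Exports.

Local Open Scope classical_set_scope.
Local Open Scope ring_scope.

Lemma continuous_sum {R : numFieldType} {T : topologicalType} {I : Type}
    (r : seq I) (F : I -> T -> R) :
  (forall i, continuous (F i)) -> continuous (fun x => \sum_(i <- r) F i x).
Proof.
move=> cF; elim: r => [|i r IHr].
  by under eq_fun do rewrite big_nil; move=> x; exact: cvg_cst.
under eq_fun do rewrite big_cons.
by move=> x; apply: cvgD; [exact: cF|exact: IHr].
Qed.

(** * Inner products and continuity of coordinates *)

Section coordinates.
Context {R : realType} {H : finHilbertType R}.
Local Notation e := (vbasis {:H}).
Local Notation ip := (@inner R H).

Lemma coord_fullE (x : H) : x = \sum_(i < \dim {:H}) coord e i x *: e`_i.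
Proof. by apply: coord_vbasis; rewrite memvf. Qed.

Lemma innerC (x y : H) : ip x y = ip y x.
Proof. by rewrite (hermC (theta := idfun)) expr0 mul1r. Qed.

(** Polarization transfers the continuity of the norm to the inner product. *)
Lemma inner_polarization (x y : H) :
  ip x y = (`|x + y| ^+ 2 - `|x| ^+ 2 - `|y| ^+ 2) / 2.
Proof.
have -> : `|x + y| ^+ 2 = ip x x + ip x y + (ip x y + ip y y).
  by rewrite sqr_norm_inner linearDl !linearDr /= [X in _ + (X + _)]innerC.
rewrite !sqr_norm_inner.
by field.
Qed.

Lemma inner_continuous (y : H) : continuous (fun x => ip x y).
Proof.
under eq_fun do rewrite inner_polarization.
move=> x; apply: cvgM; last exact: cvg_cst.
have cN (z : H) : (fun x : H => `|x + z| ^+ 2) @ x --> `|x + z| ^+ 2.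
  rewrite expr2; under eq_fun do rewrite expr2.
  by apply: cvgM; apply: cvg_norm; apply: cvgD => //; exact: cvg_cst.
apply: cvgB; last exact: cvg_cst.
apply: cvgB; first exact: cN.
by have := cN 0; under eq_fun do rewrite addr0; rewrite addr0.
Qed.

(* The Gram matrix of the basis expresses coordinates by inner products. *)
Lemma coord_continuous (i : 'I_(\dim {:H})) : continuous (coord e i : H -> R).
Proof.
pose G := \matrix_(j, k) ip e`_j e`_k : 'M[R]_(\dim {:H}).
have uG (u : 'rV[R]_(\dim {:H})) k :
    (u *m G) 0 k = ip (\sum_j u 0 j *: e`_j) e`_k.
  rewrite mxE linear_sumlz /=; apply: eq_bigr => j _.
  by rewrite mxE linearZl_LR.
(* If [u *m G = 0], the vector with coordinates [u] is orthogonal to the whole basis, hence to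
   itself, so it is zero; freeness of the basis then gives [u = 0]. *)
have Gunit : G \in unitmx.
  rewrite -row_free_unit -kermx_eq0; apply/rowV0P => u /sub_kermxP uG0.
  set x := \sum_j u 0 j *: e`_j.
  have x0 : x = 0.
    apply/eqP; rewrite -normr_eq0 -sqrf_eq0 sqr_norm_inner.
    rewrite {2}/x linear_sumr /= big1 // => k _.
    by rewrite linearZr_LR /= -uG uG0 mxE mulr0.
  apply/rowP => k; rewrite mxE.
  have /freeP -> // : free e by apply: basis_free (vbasisP _).
(* The coordinate row of [x] times [G] is the row of inner products of [x] with the basis; inverting
   [G] recovers the coordinates. *)
have coordE (x : H) :
    coord e i x = \sum_(k < \dim {:H}) ip x e`_k * invmx G k i.
  have -> : coord e i x = (\row_j coord e j x) 0 i by rewrite mxE.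
  rewrite -[\row_j _](mulmxK Gunit) mxE; apply: eq_bigr => k _.
  rewrite uG [in RHS](coord_fullE x); congr (ip _ _ * _).
  by apply: eq_bigr => j _; rewrite mxE.
rewrite (funext coordE).
apply: continuous_sum => k x; apply: cvgM; last exact: cvg_cst.
exact: inner_continuous.
Qed.

End coordinates.

Lemma filterS_lebesgue {R : realType} (P Q : R -> Prop) :
  {ae @lebesgue_measure R, forall x, P x} -> (forall x, P x -> Q x) ->
  {ae @lebesgue_measure R, forall x, Q x}.
Proof.
move=> hP PQ.
exact: (@filterS _ _ (ae_filter_ringOfSetsType lebesgue_measure) _ _ PQ hP).
Qed.

(** * Oriented integrals of real functions *)

Section oriented_integral.
Context {R : realType}.
Local Notation mu := (@lebesgue_measure R).
Implicit Types (g h c : R -> R) (a b s t : R).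

(** Measurability is kept on the whole line because translation is handled as a change of variables
    there. *)
Definition locally_integrable g :=
  measurable_fun [set: R] g /\
  forall a b, mu.-integrable `[a, b] (EFin \o g).

(** The signed integral from 0 to [t], the scalar counterpart of [vintegral0]. *)
Definition ointegral t g : R :=
  if 0 <= t then \int[mu]_(x in `[0, t]) g x
  else - \int[mu]_(x in `[t, 0]) g x.

(** Lebesgue measure is determined by its values on half-open intervals, and the preimage of such an
    interval under a translation is one of the same length. *)
Lemma lebesgue_measure_translation s (A : set R) : measurable A ->
  pushforward mu (fun x => x + s : measurableTypeR R) A = mu A.
Proof.
have ms : measurable_fun [set: R] (fun x => x + s : measurableTypeR R).
  by apply: measurable_funD => //; exact: measurable_cst.
move=> mA; apply/esym/lebesgue_measure_unique => //= _ [[a b]] _ <-.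
rewrite /pushforward.
have -> : (fun x => x + s) @^-1` `]a, b]%classic = `]a - s, b - s]%classic.
  by apply/seteqP; split => x /=; rewrite !in_itv /= ltrBlDr lerBrDr.
rewrite !lebesgue_measure_itv /= !lte_fin ltrD2r.
by case: ifPn => // _; rewrite -!EFinB; congr EFin; ring.
Qed.

Let measurable_translation s :
  measurable_fun [set: measurableTypeR R]
    (fun x : measurableTypeR R => x + s : measurableTypeR R).
Proof. by apply: measurable_funD => //; exact: measurable_cst. Qed.

Let preimage_translation s a b :
  (fun x : R => x + s) @^-1` `[a + s, b + s]%classic = `[a, b]%classic.
Proof. by apply/seteqP; split => x /=; rewrite !in_itv /= !lerD2r. Qed.

Let integral_pushforward_translation s (D : set R) (h : R -> \bar R) :
  (\int[mu]_(x in D) h x =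
   \int[pushforward mu (fun x => (x + s)%R : measurableTypeR R)]_(x in D)
      h x)%E.
Proof.
apply: eq_measure_integral => A mA _.
by rewrite -[LHS](lebesgue_measure_translation s mA).
Qed.

Lemma locally_integrable_translation s g : locally_integrable g ->
  locally_integrable (fun x => g (x + s)).
Proof.
move=> [mg ig].
have mgs : measurable_fun [set: R] (fun x => g (x + s)).
  exact: (measurableT_comp mg (measurable_translation s)).
split=> // a b; apply/integrableP; split.
  by apply: measurable_funTS; exact/measurable_EFinP.
have /integrableP[mgE] := ig (a + s) (b + s); apply: le_lt_trans.
rewrite [leRHS](integral_pushforward_translation s).
rewrite (ge0_integral_pushforward (measurable_translation s))//=.
- by rewrite preimage_translation.
- by do 2 apply: measurableT_comp => //; exact/measurable_EFinP.
Qed.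

Lemma Rintegral_translation s a b g : locally_integrable g ->
  \int[mu]_(x in `[a, b]) g (x + s) = \int[mu]_(x in `[a + s, b + s]) g x.
Proof.
move=> ig; have [mg _] := ig.
have [_ igs] := locally_integrable_translation s ig.
rewrite /Rintegral [in RHS](integral_pushforward_translation s).
rewrite (integral_pushforward (measurable_translation s) (f := EFin \o g)).
- by rewrite preimage_translation.
- exact/measurable_EFinP.
- by rewrite preimage_translation; exact: igs.
- by [].
Qed.

(** Removes the case distinction on the sign of [t]: with a base point left of both endpoints,
    either sign is an instance of [chasles]. *)
Lemma ointegralE a t g : locally_integrable g -> a <= t -> a <= 0 ->
  ointegral t g =
  \int[mu]_(x in `[a, t]) g x - \int[mu]_(x in `[a, 0]) g x.
Proof.
move=> [mg ig] at_ a0; rewrite /ointegral.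
have chasles x y : a <= x -> x <= y ->
    \int[mu]_(z in `[a, y]) g z - \int[mu]_(z in `[a, x]) g z =
    \int[mu]_(z in `[x, y]) g z.
  move=> ax xy; rewrite Rintegral_itvB ?bnd_simp//.
  rewrite Rintegral_itv_obnd_cbnd//; apply: integrableS (ig x y) => //.
  by apply: subset_itvr; rewrite bnd_simp.
case: ifPn => [t0|]; first by rewrite chasles.
by rewrite -ltNge => /ltW t0; rewrite -chasles// opprB.
Qed.

Lemma ointegral_add t s g : locally_integrable g ->
  ointegral (t + s) g = ointegral s g + ointegral t (fun x => g (x + s)).
Proof.
(* All terms are expanded from one base point left of 0, [s] and [t + s]. The shifted function uses
   the base [a - s], which translation moves back to [a], so the integrals from [a] cancel. *)
move=> ig; pose a := Num.min 0 (Num.min s (t + s)).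
have [a0 [as_ ats]] : a <= 0 /\ a <= s /\ a <= t + s.
  by rewrite /a !ge_min !lexx !orbT.
rewrite (ointegralE ig ats a0) (ointegralE ig as_ a0).
rewrite (@ointegralE (a - s)) ?lerBlDr ?add0r//; last first.
  exact: locally_integrable_translation.
by rewrite !Rintegral_translation// subrK add0r; ring.
Qed.

Lemma ointegral0 g : ointegral 0 g = 0.
Proof. by rewrite /ointegral lexx set_itv1 Rintegral_set1. Qed.

Lemma ae_eq_ointegral t g h : measurable_fun [set: R] g ->
  measurable_fun [set: R] h -> {ae mu, forall x, g x = h x} ->
  ointegral t g = ointegral t h.
Proof.
move=> mg mh gh.
have E a b : \int[mu]_(x in `[a, b]) g x = \int[mu]_(x in `[a, b]) h x.
  congr fine; apply: ae_eq_integral => //.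
  - by apply: measurable_funTS; exact/measurable_EFinP.
  - by apply: measurable_funTS; exact/measurable_EFinP.
  - by apply: (filterS_lebesgue gh) => x + _ => ->.
by rewrite /ointegral !E.
Qed.

Lemma ointegralZl k t g : locally_integrable g ->
  ointegral t (fun x => k * g x) = k * ointegral t g.
Proof.
move=> [mg ig]; rewrite /ointegral.
by case: ifP => _; rewrite RintegralZl// mulrN.
Qed.

Lemma locally_integrableD g h : locally_integrable g -> locally_integrable h ->
  locally_integrable (fun x => g x + h x).
Proof.
move=> [mg ig] [mh ih]; split; first exact: measurable_funD.
by move=> a b; exact: (integrableD _ (ig a b) (ih a b)).
Qed.

Lemma ointegralD t g h : locally_integrable g -> locally_integrable h ->
  ointegral t (fun x => g x + h x) = ointegral t g + ointegral t h.
Proof.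
move=> [mg ig] [mh ih]; rewrite /ointegral.
by case: ifP => _; rewrite RintegralD// opprD.
Qed.

Lemma locally_integrableZl k g : locally_integrable g ->
  locally_integrable (fun x => k * g x).
Proof.
move=> [mg ig]; split.
  by apply: measurable_funM => //; exact: measurable_cst.
by move=> a b; exact: (integrableZl _ k (ig a b)).
Qed.

Lemma locally_integrable0 : locally_integrable (fun=> 0).
Proof.
by split=> [|a b]; [exact: measurable_cst|exact: integrable0].
Qed.

Lemma locally_integrable_sum I (r : seq I) (F : I -> R -> R) :
  (forall i, locally_integrable (F i)) ->
  locally_integrable (fun x => \sum_(i <- r) F i x).
Proof.
move=> iF; elim: r => [|i r IHr].
  by under eq_fun do rewrite big_nil; exact: locally_integrable0.
by under eq_fun do rewrite big_cons; exact: locally_integrableD.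
Qed.

Lemma ointegral_sum t I (r : seq I) (F : I -> R -> R) :
  (forall i, locally_integrable (F i)) ->
  ointegral t (fun x => \sum_(i <- r) F i x) = \sum_(i <- r) ointegral t (F i).
Proof.
move=> iF; elim: r => [|i r IHr].
  rewrite big_nil; under eq_fun do rewrite big_nil.
  have := ointegralZl 0 t locally_integrable0.
  by rewrite !mul0r.
under eq_fun do rewrite big_cons.
by rewrite big_cons ointegralD ?IHr//; exact: locally_integrable_sum.
Qed.

(** On a segment, [c] is bounded by compactness and [g] almost everywhere by [M], and the segment
    has finite measure. *)
Lemma locally_integrableM c g M : continuous c -> measurable_fun [set: R] g ->
  {ae mu, forall x, `|g x| <= M} -> locally_integrable (fun x => g x * c x).
Proof.
move=> cc mg gM.
have mgc : measurable_fun [set: R] (fun x => g x * c x).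
  by apply: measurable_funM => //; exact: continuous_measurable_fun.
split=> // a b; apply/integrableP; split.
  by apply: measurable_funTS; exact/measurable_EFinP.
have /compact_bounded[K [_ cK]] : compact (c @` `[a, b]).
  apply: continuous_compact; last exact: segment_compact.
  exact: continuous_subspaceT.
(* The absolute values ensure [0 <= N]; the added 1 is there because [cK] applies only to bounds
   strictly above [K]. *)
pose N := `|M| * (`|K| + 1).
have N0 : 0 <= N by rewrite mulr_ge0// addr_ge0.
apply: (@le_lt_trans _ _ (N%:E * mu `[a, b])%E).
  apply: integral_le_bound => //.
    by apply: measurable_funTS; exact/measurable_EFinP.
  apply: (filterS_lebesgue gM) => x gxM abx /=; rewrite lee_fin normrM ler_pM//.
    exact: le_trans (ler_norm _).
  apply: (cK (`|K| + 1)); last by exists x.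
  by rewrite ltr_pwDr// ler_norm.
rewrite lte_mul_pinfty ?lee_fin//.
by rewrite lebesgue_measure_itv /=; case: ifP => _; rewrite ?ltry.
Qed.

End oriented_integral.

(** * From almost everywhere to everywhere *)

Section almost_everywhere.
Context {R : realType}.
Local Notation mu := (@lebesgue_measure R).

(** A nonempty open set missing [P] would contain a ball inside the exceptional null set, but balls
    have positive measure. *)
Lemma ae_dense (P : R -> Prop) :
  {ae mu, forall s, P s} -> dense [set s | P s].
Proof.
move=> [N [mN N0 NP]]; apply: contrapT => /denseNE[V [[x [oV Vx]] VP]].
have /nbhs_ballP[e /= e0 xe] : nbhs x V.
  exact: open_nbhs_nbhs.
have : (mu (ball x e) <= mu N)%E.
  apply: le_measure; rewrite ?inE//; first exact: measurable_ball.
  move=> y /xe Vy; apply: NP => Py.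
  by have : (V `&` [set s | P s]) y by []; rewrite VP.
rewrite (lebesgue_measure_ball _ (ltW e0)) N0.
by rewrite lee_fin leNgt pmulrn_lgt0 ?e0.
Qed.

(** The set where [g] and [h] differ is open; were it nonempty, it would meet the dense set where
    they agree. *)
Lemma continuous_ae_eq (U : normedModType R) (g h : R -> U) :
  continuous g -> continuous h -> {ae mu, forall s, g s = h s} -> g =1 h.
Proof.
move=> cg ch gh x; apply: contrapT => /eqP; rewrite -subr_eq0 -normr_gt0 => d0.
have c : continuous (fun s => `|g s - h s|).
  by move=> s; apply: cvg_norm; apply: cvgB; [exact: cg|exact: ch].
have oD : open [set s | 0 < `|g s - h s|].
  apply: (@open_comp _ _ (fun s => `|g s - h s|) [set y | 0 < y]).
    by move=> s _; exact: c.
  exact: open_gt.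
have [|s [/= + ghs]] := ae_dense gh _ oD; first by exists x.
by rewrite ghs subrr normr0 ltxx.
Qed.

End almost_everywhere.

(** * Vector integrals, coordinate by coordinate *)

Section vector_integral.
Context {R : realType} {H : finHilbertType R}.
Local Notation mu := (@lebesgue_measure R).
Local Notation e := (vbasis {:H}).
Local Notation n := (\dim {:H}).
Implicit Types (g h : R -> H) (s t : R) (x y : H).

Definition coords_integrable g :=
  forall i : 'I_n, locally_integrable (fun s => coord e i (g s)).

Lemma vintegral0E t g :
  vintegral0 t g =
  \sum_(i < n) ointegral t (fun s => coord e i (g s)) *: e`_i.
Proof.
rewrite /vintegral0 /ointegral /vintegral; case: ifP => // _.
by rewrite -sumrN; apply: eq_bigr => i _; rewrite scaleNr.
Qed.

Lemma coord_vintegral0 t g i :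
  coord e i (vintegral0 t g) = ointegral t (fun s => coord e i (g s)).
Proof. by rewrite vintegral0E coord_sum_free// (basis_free (vbasisP _)). Qed.

Lemma vintegral0_add t s g : coords_integrable g ->
  vintegral0 (t + s) g = vintegral0 s g + vintegral0 t (fun u => g (u + s)).
Proof.
move=> ig; rewrite !vintegral0E -big_split /=; apply: eq_bigr => i _.
by rewrite -scalerDl ointegral_add.
Qed.

Lemma coord_linear (L : H -> H) i x : linear L ->
  coord e i (L x) = \sum_(j < n) coord e i (L e`_j) * coord e j x.
Proof.
move=> linL; pose L' : {linear H -> H} :=
  HB.pack L (GRing.isLinear.Build _ _ _ _ L linL).
rewrite {1}(coord_fullE x) -[L]/(L' : H -> H) !linear_sum.
by apply: eq_bigr => j _; rewrite !linearZ /= mulrC.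
Qed.

(** In the basis, [L] acts by a constant matrix, so linearity of the scalar integral applies to each
    coordinate. *)
Lemma linear_vintegral0 (L : H -> H) t g : linear L -> coords_integrable g ->
  L (vintegral0 t g) = vintegral0 t (fun s => L (g s)).
Proof.
move=> linL ig; rewrite [LHS]coord_fullE [RHS]vintegral0E.
apply: eq_bigr => i _; congr (_ *: _); rewrite coord_linear//.
under [in RHS]eq_fun do rewrite coord_linear//.
have iL (j : 'I_n) :
    locally_integrable (fun s => coord e i (L e`_j) * coord e j (g s)).
  exact: locally_integrableZl.
rewrite ointegral_sum//; apply: eq_bigr => j _.
by rewrite ointegralZl ?coord_vintegral0.
Qed.

Lemma ae_eq_vintegral0 t g h : coords_integrable g -> coords_integrable h ->
  {ae mu, forall s, g s = h s} -> vintegral0 t g = vintegral0 t h.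
Proof.
move=> ig ih gh; rewrite !vintegral0E; apply: eq_bigr => i _.
congr (_ *: _); apply: ae_eq_ointegral; [exact: (ig i).1|exact: (ih i).1|].
by apply: (filterS_lebesgue gh) => s /= ->.
Qed.

Lemma Linfty_coord (f : Linfty H) (i : 'I_n) :
  measurable_fun [set: R] (fun s => coord e i (f s)) /\
  exists M, {ae mu, forall s, `|coord e i (f s)| <= M}.
Proof.
split.
  have mf := Linfty_measurable f.
  (* Open intervals generate the Borel sets of the line, and their preimages under a continuous
     coordinate are open in [H]. *)
  apply: (measurability _ (RGenOpens.measurableE R)) => //= _ [_ [a [b ->]] <-].
  apply: (mf measurableT (coord e i @^-1` `]a, b[%classic)).
  apply: sub_sigma_algebra; apply: open_comp (interval_open _ _) => // x _.
  exact: coord_continuous.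
have [M fM] := ess_supr_bounded (Linfty_bounded f).
(* A continuous linear functional has a global operator bound, which turns the essential bound on
   [f] into one on its coordinate. *)
have [K cK] : exists K, forall x : H, `|coord e i x| <= K * `|x|.
  have : bounded_near (coord e i : {linear H -> R^o}) (nbhs (0 : H)).
    by apply: continuous_linear_bounded; exact: coord_continuous.
  by move=> /linear_boundedP/pinfty_ex_gt0[K _ cK]; exists K.
exists (`|K| * M).
apply: (filterS_lebesgue fM) => s /= fsM.
apply: (le_trans (cK _)); apply: (@le_trans _ _ (`|K| * `|f s|)).
  by rewrite ler_wpM2r// ler_norm.
by rewrite ler_wpM2l.
Qed.

(** Each coordinate is a finite sum of products of a matrix entry of [A s], continuous in [s], and
    an essentially bounded coordinate of [f]. *)
Lemma cocycle_coords_integrable (A : R -> H -> H) (f : Linfty H) :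
  (forall s, linear (A s)) -> (forall x, continuous (A ^~ x)) ->
  coords_integrable (fun s => A s (f s)).
Proof.
move=> linA cA i; under eq_fun do rewrite coord_linear//.
apply: locally_integrable_sum => j.
have [mf [M fM]] := Linfty_coord f j.
under eq_fun do rewrite mulrC.
apply: locally_integrableM fM => //.
move=> s; apply: continuous_comp; [exact: cA|exact: coord_continuous].
Qed.

End vector_integral.

(** * Continuity of pairs, components and composites *)

Section continuity.
Context {T U V : topologicalType}.

Lemma continuous_pair (f : T -> U) (g : T -> V) :
  continuous f -> continuous g -> continuous (fun x => (f x, g x)).
Proof. by move=> cf cg x; apply: cvg_pair; [exact: cf|exact: cg]. Qed.

Lemma continuous_fst_comp (f : T -> U * V) :
  continuous f -> continuous (fun x => (f x).1).
Proof. by move=> cf x; apply: (cvg_comp _ _ (cf x)); exact: cvg_fst. Qed.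

Lemma continuous_snd_comp (f : T -> U * V) :
  continuous f -> continuous (fun x => (f x).2).
Proof. by move=> cf x; apply: (cvg_comp _ _ (cf x)); exact: cvg_snd. Qed.

Lemma continuous_fun_comp (f : T -> U) (g : U -> V) :
  continuous f -> continuous g -> continuous (fun x => g (f x)).
Proof. by move=> cf cg x; apply: continuous_comp; [exact: cf|exact: cg]. Qed.

End continuity.

(** * The cocycle identity for the forcing term and the lifted flow *)

Section cocycle.
Context {R : realType} {B : metricType R} {H : finHilbertType R}.
Local Notation mu := (@lebesgue_measure R).
Variables (theta : R -> B -> B) (phi : R -> B -> H -> H) (f : B -> Linfty H).
Hypothesis Phi_flow : linear_flow theta phi.

Lemma base_continuous {T : topologicalType} (a : T -> R) (b : T -> B) :
  continuous a -> continuous b -> continuous (fun z => theta (a z) (b z)).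
Proof.
move=> ca cb; have [[cth _ _] _ _] := Phi_flow.
exact: (continuous_fun_comp (continuous_pair ca cb) cth).
Qed.

Lemma fiber_continuous {T : topologicalType} (a : T -> R) (b : T -> B)
    (x : T -> H) : continuous a -> continuous b -> continuous x ->
  continuous (fun z => phi (a z) (b z) (x z)).
Proof.
move=> ca cb cx; have [_ _ [cPhi _ _]] := Phi_flow.
exact: (continuous_snd_comp (continuous_fun_comp
  (continuous_pair ca (continuous_pair cb cx)) cPhi)).
Qed.

Lemma fiber0 b x : phi 0 b x = x.
Proof. by have [_ _ [_ /(_ (b, x)) [_ //]]] := Phi_flow. Qed.

Lemma fiber_cocycle t s b x : phi (t + s) b x = phi t (theta s b) (phi s b x).
Proof. by have [_ _ [_ _ /(_ t s (b, x)) [_ //]]] := Phi_flow. Qed.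

Lemma integrand_coords_integrable t b (h : Linfty H) :
  coords_integrable (fun u => phi (t - u) (theta u b) (h u)).
Proof.
have [_ linphi _] := Phi_flow.
apply: (cocycle_coords_integrable (A := fun u => phi (t - u) (theta u b))).
  by move=> u; exact: linphi.
move=> x; apply: fiber_continuous.
- by move=> u; apply: cvgB; [exact: cvg_cst|exact: cvg_id].
- apply: base_continuous; first by move=> u; exact: cvg_id.
  by move=> u; exact: cvg_cst.
- by move=> u; exact: cvg_cst.
Qed.

Lemma forcing_cocycle_ae t s b :
  {ae mu, forall u, f b (u + s) = f (theta s b) u} ->
  forcing theta phi f (t + s) b =
  phi t (theta s b) (forcing theta phi f s b) +
  forcing theta phi f t (theta s b).
Proof.
move=> fs; have [[_ _ thD] linphi _] := Phi_flow.
have ig := integrand_coords_integrable (t + s) b (f b).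
rewrite {1}/forcing vintegral0_add//; congr (_ + _).
  rewrite linear_vintegral0//; last exact: integrand_coords_integrable.
  congr vintegral0; apply/funext => u.
  (* Writing [t + s - u] as [t + (s - u)], the cocycle splits off [phi t] at the base point reached
     from [theta u b] after time [s - u], which is [theta s b]. *)
  by rewrite -addrA (fiber_cocycle t) -thD subrK.
(* After the shift by [s], the elapsed time is [t - u] and the base point is [theta u (theta s b)];
   only the values of [f] remain to be compared, almost everywhere in [u]. *)
apply: ae_eq_vintegral0.
- by move=> i; exact: (locally_integrable_translation s (ig i)).
- exact: integrand_coords_integrable.
- apply: (filterS_lebesgue fs) => u /= ->.
  by rewrite thD opprD addrACA subrr addr0.
Qed.

Hypothesis forcing_continuous :
  continuous (fun p : R * B => forcing theta phi f p.1 p.2).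
Hypothesis f_translation : forall b,
  {ae mu, forall s, {ae mu, forall t, f b (t + s) = f (theta s b) t}}.

Lemma forcing_comp_continuous {T : topologicalType} (a : T -> R) (b : T -> B) :
  continuous a -> continuous b ->
  continuous (fun z => forcing theta phi f (a z) (b z)).
Proof.
move=> ca cb.
exact: (continuous_fun_comp (continuous_pair ca cb) forcing_continuous).
Qed.

Lemma forcing_cocycle t s b :
  forcing theta phi f (t + s) b =
  phi t (theta s b) (forcing theta phi f s b) +
  forcing theta phi f t (theta s b).
Proof.
have cid : continuous (fun x : R => x) by move=> x; exact: cvg_id.
have ccst (T : topologicalType) (c : T) : continuous (fun _ : R => c).
  by move=> x; exact: cvg_cst.
have cth : continuous (fun s => theta s b).
  exact: (base_continuous cid (@ccst B b)).
move: s; apply: continuous_ae_eq.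
- apply: forcing_comp_continuous (@ccst B b) => s.
  by apply: cvgD; [exact: cvg_cst|exact: cvg_id].
- move=> s; apply: cvgD.
    apply: fiber_continuous (@ccst R t) cth _ _.
    exact: forcing_comp_continuous cid (@ccst B b).
  exact: forcing_comp_continuous (@ccst R t) cth _.
- apply: (filterS_lebesgue (f_translation b)).
  by move=> s; exact: forcing_cocycle_ae.
Qed.

Lemma forcing0 b : forcing theta phi f 0 b = 0.
Proof.
by rewrite /forcing vintegral0E big1// => i _; rewrite ointegral0 scale0r.
Qed.

(** The forcing enters with the factor [r], which makes the fiber map linear in the pair; since [r]
    stays constant in time, [r] times the cocycle identity gives the flow law. *)
Lemma linear_flow_affine_lift :
  linear_flow theta (affine_lift theta phi f).
Proof.
have [fth linphi [_ _ _]] := Phi_flow; have [_ th0 thD] := fth.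
split=> //.
  move=> t b k [x r] [y q]; rewrite /affine_lift /=; congr pair.
  set F := forcing _ _ _ _ _.
  rewrite -[RHS]/(k *: (phi t b x + r *: F) + (phi t b y + q *: F)).
  by rewrite linphi scalerDl scalerDr scalerA addrACA.
split.
- have cfst (U V : topologicalType) : continuous (@fst U V).
    by move=> x; exact: cvg_fst.
  have csnd (U V : topologicalType) : continuous (@snd U V).
    by move=> x; exact: cvg_snd.
  have cb := continuous_fst_comp (@csnd R (B * (H * R^o))%type).
  have cxr := continuous_snd_comp (@csnd R (B * (H * R^o))%type).
  have cx := continuous_fst_comp cxr; have cr := continuous_snd_comp cxr.
  have ct := @cfst R (B * (H * R^o))%type.
  apply: continuous_pair; first exact: base_continuous ct cb.
  apply: continuous_pair => // p; apply: cvgD.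
    exact: (fiber_continuous ct cb cx).
  by apply: cvgZ; [exact: cr|exact: (forcing_comp_continuous ct cb)].
- move=> [b [x r]]; rewrite /Defs.skew /affine_lift /=.
  by rewrite th0 fiber0 forcing0 scaler0 addr0.
- move=> t s [b [x r]]; rewrite /Defs.skew /affine_lift /= thD.
  congr (_, (_, _)).
  (* The summand scaled by [r] is put first, the shape in which [linphi] applies. *)
  rewrite fiber_cocycle forcing_cocycle [phi s b x + _]addrC linphi.
  by rewrite scalerDr addrA; congr (_ + _); rewrite addrC.
Qed.

End cocycle.

(** * Application to affine flows *)

Theorem proposition7 (R : realType) (B : metricType R) (H : finHilbertType R)
    (theta : R -> B -> B) (phi : R -> B -> H -> H) (f : B -> Linfty H)
    (psi : R -> B -> H -> H) :
  compact [set: B] ->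
  flow theta ->
  chain_transitive theta ->
  affine_flow theta phi f psi ->
  linear_flow theta (affine_lift theta phi f).
Proof.
move=> _ _ _ [Phi_flow f_translation psiE psi_continuous].
apply: linear_flow_affine_lift => //.
have phi0 t b : phi t b 0 = 0.
  (* Linearity at [-1 *: 0 + 0] equates the value at 0 with the sum of its opposite and itself. *)
  have [_ /(_ t b) /(_ (-1) 0 0) + _] := Phi_flow.
  by rewrite scaler0 addr0 scaleN1r addNr.
have forcingE t b : forcing theta phi f t b = psi t b 0.
  by rewrite psiE phi0 add0r.
(* Joint continuity of the forcing is read off from [psi] along the zero section, with no estimate
   on the integral. *)
rewrite (_ : (fun p => _) = (fun p : R * B => psi p.1 p.2 0)); last first.
  by apply/funext => p.
have cp : continuous (fun p : R * B => (p.1, (p.2, 0 : H))).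
  apply: continuous_pair; first by move=> p; exact: cvg_fst.
  by apply: continuous_pair => p; [exact: cvg_snd|exact: cvg_cst].
exact: (continuous_snd_comp (continuous_fun_comp cp psi_continuous)).
Qed.
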